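(* Let $k,d\ge 1$ be integers and let $p$ and $q$ be positive definite forms on $\mathbb{R}^n$ such that the rational function $\frac{p}{q}$ is homogeneous of degree $2kd$. Then $\frac{p}{q}$ can be written as a (finite) sum of $2d$-th powers of $(k-1)$-regulous functions on $\mathbb{R}^n$. In particular, $\frac{p}{q}$ is a sum of squares of functions on $\mathbb{R}^n$ of class at least $\mathcal{C}^{kd-1}$.
   Context: A form is a homogeneous real polynomial in $x_1,\dots,x_n$. A form $p$ is positive definite if $p(x)>0$ for all $x\in\mathbb{R}^n\setminus\{0\}$. The function $p/q$ is regarded as a continuous function on $\mathbb{R}^n$, with value $0$ at the origin. It is homogeneous of degree $2kd$ when $\deg p-\deg q=2kd$. For an integer $m\ge 0$, a function $f:\mathbb{R}^n\to\mathbb{R}$ is called $m$-regulous if it is of class $\mathcal{C}^m$ and is a rational function, i.e. there is a non-empty Zariski open subset $U\subset\mathbb{R}^n$ such that $f|_U$ is regular (a quotient of polynomials whose denominator does not vanish on $U$). *)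

(* Defs.v *)
From HB Require Import structures.
From mathcomp Require Import all_boot all_order all_algebra.
From mathcomp Require Import all_classical all_reals all_analysis.
(* The notations of mpoly are left out: they clash with those of the analysis
   library. *)
From mathcomp Require Import (coercions, canonicals) mpoly.

Set Implicit Arguments.
Unset Strict Implicit.
Unset Printing Implicit Defensive.

Import Order.TTheory GRing.Theory Num.Theory.
Import numFieldNormedType.Exports.

Local Open Scope classical_set_scope.
Local Open Scope ring_scope.

(* Points of R^n are row vectors. *)
Definition peval (R : realType) (n : nat) (p : mpoly.mpoly n R)
    (x : 'rV[R]_n) : R :=
  mpoly.meval (fun i => x ord0 i) p.

(* The zero polynomial is homogeneous of every degree; a nonzero form has
   exactly one degree. *)
Definition is_form (R : realType) (n e : nat) (p : mpoly.mpoly n R) : Prop :=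
  p \is mpoly.ishomog1 e (@mpoly.mdeg n).

Definition positive_definite (R : realType) (n : nat)
    (p : mpoly.mpoly n R) : Prop :=
  forall x : 'rV[R]_n, x != 0 -> 0 < peval p x.

Definition ratfun (R : realType) (n : nat) (p q : mpoly.mpoly n R)
    (x : 'rV[R]_n) : R :=
  if x == 0 then 0 else peval p x / peval q x.

(* f is of class C^m: all iterated partial derivatives of order at most m
   exist everywhere and are continuous. *)
Fixpoint classC (R : realType) (n m : nat) (f : 'rV[R]_n -> R) : Prop :=
  match m with
  | 0 => continuous f
  | m'.+1 => continuous f /\
      forall i : 'I_n,
        (forall x, derivable f x (delta_mx ord0 i)) /\
        classC m' (fun x => 'D_(delta_mx ord0 i) f x)
  end.

Definition zariski_open (R : realType) (n : nat) (U : set 'rV[R]_n) : Prop :=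
  exists S : set (mpoly.mpoly n R),
    U = [set x | exists2 g, S g & peval g x != 0].

Definition regular_on (R : realType) (n : nat) (U : set 'rV[R]_n)
    (f : 'rV[R]_n -> R) : Prop :=
  exists a b : mpoly.mpoly n R,
    forall x, U x -> peval b x != 0 /\ f x = peval a x / peval b x.

Definition regulous (R : realType) (n m : nat) (f : 'rV[R]_n -> R) : Prop :=
  classC m f /\
  exists U : set 'rV[R]_n, [/\ zariski_open U, U !=set0 & regular_on U f].

(* Main.v *)
(* Clearing denominators, it suffices to show that a positive definite form P
   of degree D m, with D = 2 d, becomes a sum of D-th powers of forms after
   multiplication by the D-th power of a suitable positive definite form.
   Embed R^n into R^J by the D-th powers y_j = l_j(x)^D of the linear forms
   l_j = x_b + h x_c, 0 <= h <= D. The linear span of the y_j contains all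
   x_b^(D-k) x_c^k, and products of these give every form up to a positive
   definite factor, so P can be assumed to be a form G in the y_j. Modulo the
   common scaling, the image of the embedding is the zero set, in the simplex,
   of a nonnegative form H in y. By compactness G + C H is positive on the
   whole simplex for some C, so by Polya's theorem (sum_j y_j)^N (G + C H) has
   nonnegative coefficients for large N. Substituting y_j = l_j(x)^D kills H
   and turns every monomial into a D-th power.
   A quotient of forms that is homogeneous of degree m + 1, with positive
   definite denominator, is of class C^m: its partial derivatives are of the
   same kind, with degree m. *)
Require Import Defs.
From HB Require Import structures.
From mathcomp Require Import all_boot all_order all_algebra.
From mathcomp Require Import all_classical all_reals all_analysis.
From mathcomp Require Import (coercions, canonicals) mpoly.
From mathcomp Require Import ring lra zify.

Set Implicit Arguments.
Unset Strict Implicit.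
Unset Printing Implicit Defensive.

Import Order.TTheory GRing.Theory Num.Theory.
Import numFieldNormedType.Exports.

Local Open Scope ring_scope.

(** * Forms as functions with a degree *)

Section HomogeneousPolynomials.
Variables (R : realType) (J : finType).
Implicit Types f g : (J -> R) -> R.

(** Forms are functions built along a derivation that records the degree, so that homogeneity,
    differentiation and substitution become inductions, over any finite set of variables. *)
Inductive hpoly : nat -> ((J -> R) -> R) -> Prop :=
| hpoly_zero m : hpoly m (fun=> 0)
| hpoly_cst c : hpoly 0 (fun=> c)
| hpoly_var j : hpoly 1 (fun y => y j)
| hpoly_add m f g : hpoly m f -> hpoly m g -> hpoly m (fun y => f y + g y)
| hpoly_mul m n f g :
    hpoly m f -> hpoly n g -> hpoly (m + n) (fun y => f y * g y).

Lemma hpoly_eq m m' f g : hpoly m f -> m = m' -> f =1 g -> hpoly m' g.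
Proof. by move=> hf <- /funext <-. Qed.

Lemma hpolyZ m c f : hpoly m f -> hpoly m (fun y => c * f y).
Proof. by move=> hf; apply: hpoly_eq (hpoly_mul (hpoly_cst c) hf) _ _. Qed.

Lemma hpolyB m f g : hpoly m f -> hpoly m g -> hpoly m (fun y => f y - g y).
Proof.
move=> hf hg; apply: hpoly_eq (hpoly_add hf (hpolyZ (-1) hg)) _ _ => // y.
by rewrite mulN1r.
Qed.

Lemma hpolyX m n f : hpoly m f -> hpoly (m * n) (fun y => f y ^+ n).
Proof.
move=> hf; elim: n => [|n IH].
  by apply: hpoly_eq (hpoly_cst 1) _ _; rewrite ?muln0.
by apply: hpoly_eq (hpoly_mul hf IH) _ _; rewrite ?mulnS// => y; rewrite exprS.
Qed.

Lemma hpoly_sum m (I : Type) (r : seq I) (P : pred I) (F : I -> (J -> R) -> R) :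
  (forall i, P i -> hpoly m (F i)) ->
  hpoly m (fun y => \sum_(i <- r | P i) F i y).
Proof.
move=> hF; elim: r => [|i r IH].
  by apply: hpoly_eq (hpoly_zero m) _ _ => // y; rewrite big_nil.
have [Pi|Pi] := boolP (P i).
  by apply: hpoly_eq (hpoly_add (hF i Pi) IH) _ _ => // y; rewrite big_cons Pi.
by apply: hpoly_eq IH _ _ => // y; rewrite big_cons (negPf Pi).
Qed.

Lemma hpoly_prod (I : Type) (r : seq I) (e : I -> nat)
    (F : I -> (J -> R) -> R) :
  (forall i, hpoly (e i) (F i)) ->
  hpoly (\sum_(i <- r) e i)%N (fun y => \prod_(i <- r) F i y).
Proof.
move=> hF; elim: r => [|i r IH].
  by apply: hpoly_eq (hpoly_cst 1) _ _ => [|y]; rewrite big_nil.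
by apply: hpoly_eq (hpoly_mul (hF i) IH) _ _ => [|y]; rewrite big_cons.
Qed.

Lemma hpoly_homog m f t y : hpoly m f -> f (fun j => t * y j) = t ^+ m * f y.
Proof.
elim=> {m f} [m|c|j|m f g _ IHf _ IHg|m n f g _ IHf _ IHg].
- by rewrite mulr0.
- by rewrite mul1r.
- by rewrite expr1.
- by rewrite IHf IHg mulrDr.
- by rewrite IHf IHg exprD mulrACA.
Qed.

(** Coefficients are attached to words of variables rather than to monomials. They are not unique,
    but multiplication becomes concatenation of words and no multinomial coefficients appear. *)
Lemma hpoly_tensor m f : hpoly m f ->
  exists a : {ffun 'I_m -> J} -> R,
    forall y, f y = \sum_w a w * \prod_i y (w i).
Proof.
elim=> {m f} [m|c|j|m f g _ [a Ha] _ [b Hb]|m n f g _ [a Ha] _ [b Hb]].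
- by exists (fun=> 0) => y; rewrite big1// => w _; rewrite mul0r.
- exists (fun=> c) => y.
  under eq_bigr do rewrite big_ord0 mulr1.
  by rewrite sumr_const card_ffun card_ord expn0 mulr1n.
- exists (fun w => (w ord0 == j)%:R) => y.
  rewrite (bigD1 [ffun=> j])//= ffunE eqxx mul1r big_ord1 ffunE big1 ?addr0//.
  move=> w wj; case: eqP => [wj0|_]; last by rewrite mul0r.
  by case/eqP: wj; apply/ffunP => i; rewrite ord1 ffunE.
- exists (fun w => a w + b w) => y; rewrite Ha Hb -big_split.
  by apply: eq_bigr => w _; rewrite mulrDl.
exists (fun u => a [ffun i => u (lshift n i)] * b [ffun i => u (rshift m i)]).
move=> y; rewrite Ha Hb big_distrlr /= pair_big /=.
(* [h] concatenates two words and [h'] cuts a word after its first [m] letters. *)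
pose h (p : {ffun 'I_m -> J} * {ffun 'I_n -> J}) : {ffun 'I_(m + n) -> J} :=
  [ffun k : 'I_(m + n) =>
    match fintype.split k with inl i => p.1 i | inr i => p.2 i end].
pose h' (u : {ffun 'I_(m + n) -> J}) :=
  ([ffun i => u (lshift n i)], [ffun i => u (rshift m i)]).
have hl p i : h p (lshift n i) = p.1 i.
  by rewrite ffunE -[lshift n i]/(unsplit (inl i)) unsplitK.
have hr p i : h p (rshift m i) = p.2 i.
  by rewrite ffunE -[rshift m i]/(unsplit (inr i)) unsplitK.
have hK : cancel h h'.
  by case=> u v; congr pair; apply/ffunP => i; rewrite ffunE ?hl ?hr.
have h'K : cancel h' h.
  move=> u; apply/ffunP => k; rewrite -[k]splitK.
  by case: (fintype.split k) => i; rewrite /= ?hl ?hr ffunE.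
rewrite [RHS](reindex h) /=; last by apply: onW_bij; exists h'.
apply: eq_bigr => p _; rewrite big_split_ord /= mulrACA.
congr (a _ * b _ * (_ * _)).
- by apply/ffunP => i; rewrite ffunE hl.
- by apply/ffunP => i; rewrite ffunE hr.
- by apply: eq_bigr => i _; rewrite hl.
- by apply: eq_bigr => i _; rewrite hr.
Qed.

End HomogeneousPolynomials.

(** * Polya's theorem on positive forms on the simplex *)

Section Polya.
Variables (R : realType) (J : finType).

Lemma ffact_le_expn m L : (L ^_ m <= L ^ m)%N.
Proof.
rewrite ffact_prod -[m in (_ ^ m)%N]card_ord -prod_nat_const.
by apply: leq_prod => i _; exact: leq_subr.
Qed.

(** Among the [L ^ m] maps from [m] points to [L] points, a proportion of at most [m ^ 2 / L] is not
    injective; denominators are cleared. *)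
Lemma expn_le_ffact m L : (L ^ m * L <= L * L ^_ m + m ^ 2 * L ^ m)%N.
Proof.
elim: m => [|m IH]; first by rewrite expn0 ffactn0 mul1n muln1 addn0.
have step : (L * L ^_ m <= L ^_ m.+1 + m * L ^ m)%N.
  apply: (@leq_trans (L ^_ m * (L - m) + m * L ^_ m)).
    rewrite [(m * _)%N]mulnC -mulnDr mulnC leq_mul2l; apply/orP; right; lia.
  by rewrite -ffactnSr leq_add2l leq_mul2l ffact_le_expn orbT.
rewrite expnS -mulnA.
apply: leq_trans (leq_mul (leqnn L) IH) _.
rewrite mulnDr.
apply: leq_trans (leq_add (leq_mul (leqnn L) step) (leqnn _)) _.
rewrite mulnDr -addnA leq_add2l mulnCA [(L * (m ^ 2 * _))%N]mulnCA -mulnDl.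
rewrite leq_mul2r; apply/orP; right; nia.
Qed.

(* The coefficient of the word [w] is the average of [a (w \o s)] over the
   injections [s]. For large [L] it is close to the average over all [s], which
   is the value of the form at the vector of letter frequencies of [w]. *)
Lemma polya m (a : {ffun 'I_m -> J} -> R) (delta : R) : 0 < delta ->
  (forall y : J -> R, (forall j, 0 <= y j) -> \sum_j y j = 1 ->
    delta <= \sum_v a v * \prod_i y (v i)) ->
  exists L0 : nat, forall L, (L0 <= L)%N ->
  exists c : {ffun 'I_L -> J} -> R, (forall w, 0 <= c w) /\
  forall y : J -> R, (\sum_j y j) ^+ (L - m) * \sum_v a v * \prod_i y (v i) =
    \sum_w c w * \prod_i y (w i).
Proof.
move=> delta_gt0 Ha.
pose B : R := \sum_v `|a v|.
have aB v : a v <= B.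
  by rewrite (le_trans (ler_norm _))// /B (bigD1 v)//= lerDl sumr_ge0.
have B_ge0 : 0 <= B by apply: sumr_ge0.
(* The first bound provides injections; the second gives [m ^ 2 * B <= delta * L], which makes the
   non-injective maps negligible against [delta]. *)
exists (maxn m.+1 (Num.truncn (m%:R ^+ 2 * B / delta)).+1) => L.
rewrite geq_max => /andP[mL] HL.
have L_gt0 : (0 < L)%N by apply: leq_ltn_trans mL.
have LR : 0 < L%:R :> R by rewrite ltr0n.
have {}HL : m%:R ^+ 2 * B <= delta * L%:R.
  rewrite -ler_pdivrMl// mulrC; apply: ltW.
  by rewrite -truncn_lt_nat// divr_ge0 ?mulr_ge0 ?exprn_ge0// ltW.
pose comp (w : {ffun 'I_L -> J}) (s : {ffun 'I_m -> 'I_L}) : {ffun 'I_m -> J} :=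
  [ffun i => w (s i)].
pose S := [set s : {ffun 'I_m -> 'I_L} | injectiveb s].
have cS : #|S| = L ^_ m by rewrite card_inj_ffuns !card_ord.
have S_gt0 : 0 < #|S|%:R :> R by rewrite ltr0n cS ffact_gt0 ltnW.
exists (fun w => (#|S|%:R)^-1 * \sum_(s in S) a (comp w s)); split.
  move=> w; rewrite mulr_ge0 ?invr_ge0 ?ler0n//.
  have avg : delta * L%:R ^+ m <= \sum_s a (comp w s).
    pose y j : R := \sum_l (w l == j)%:R / L%:R.
    have y0 j : 0 <= y j by apply: sumr_ge0 => l _; rewrite divr_ge0.
    have y1 : \sum_j y j = 1.
      rewrite exchange_big /= (eq_bigr (fun=> L%:R^-1)); last first.
        move=> l _; rewrite (bigD1 (w l))//= eqxx div1r big1 ?addr0// => j.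
        by rewrite eq_sym => /negPf->; rewrite mul0r.
      by rewrite sumr_const card_ord -[L%:R^-1 *+ _]mulr_natl mulfV ?gt_eqF.
    have := Ha y y0 y1.
    have -> : \sum_v a v * \prod_i y (v i) =
        (L%:R ^- m) * \sum_s a (comp w s).
      rewrite mulr_sumr.
      under eq_bigr => v _ do rewrite bigA_distr_bigA mulr_sumr.
      rewrite exchange_big /=; apply: eq_bigr => s _.
      rewrite (bigD1 (comp w s))//= [X in _ + X]big1 ?addr0.
        rewrite mulrC; congr (_ * _).
        rewrite (eq_bigr (fun=> L%:R^-1)).
          by rewrite prodr_const card_ord exprVn.
        by move=> i _; rewrite ffunE eqxx div1r.
      move=> v vs; have [i ci] : exists i, w (s i) != v i.
        apply/existsP; apply: contraNT vs => /existsPn vs; apply/eqP/ffunP => i.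
        by rewrite ffunE; have /negPn/eqP := vs i.
      by rewrite (bigD1 i)//= (negPf ci) !mul0r mulr0.
    by rewrite mulrC ler_pdivlMr ?exprn_gt0// mulrC.
  have split_sum : \sum_s a (comp w s) =
      \sum_(s in S) a (comp w s) + \sum_(s in ~: S) a (comp w s).
    rewrite (bigID (mem S))/=; congr (_ + _).
    by apply: eq_bigl => s; rewrite !inE.
  have bad : \sum_(s in ~: S) a (comp w s) <= (L%:R ^+ m - #|S|%:R) * B.
    apply: (@le_trans _ _ (\sum_(s in ~: S) B)); first exact: ler_sum.
    rewrite sumr_const -[B *+ _]mulr_natl ler_wpM2r//.
    rewrite lerBrDr -natrD addnC cardsC card_ffun !card_ord natrX//.
  (* The non-injective maps contribute at most the lower bound [delta * L ^ m] for the sum over all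
     maps, so the sum over [S] stays nonnegative. *)
  have few : (L%:R ^+ m - #|S|%:R) * B * L%:R <= delta * L%:R ^+ m * L%:R.
    apply: (@le_trans _ _ (m%:R ^+ 2 * L%:R ^+ m * B)); last first.
      have -> : m%:R ^+ 2 * L%:R ^+ m * B = m%:R ^+ 2 * B * L%:R ^+ m by ring.
      have -> : delta * L%:R ^+ m * L%:R = delta * L%:R * L%:R ^+ m by ring.
      by rewrite ler_wpM2r// exprn_ge0.
    rewrite mulrAC ler_wpM2r// mulrBl cS lerBlDl [X in _ <= X + _]mulrC.
    by rewrite -!natrX -!natrM -natrD ler_nat expn_le_ffact.
  rewrite ler_pM2r// in few; lra.
move=> y.
under [RHS]eq_bigr do rewrite -mulrA -[X in _ * X]mulrC mulr_sumr.
rewrite -mulr_sumr exchange_big /=.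
(* Each injection [s] alone already yields the whole product, so averaging over [S] changes nothing.
   Words [w] are grouped by [v = comp w s]: the letters on the image of [s] are prescribed and the
   other [L - m] are free. *)
rewrite [X in _ = _ * X](eq_bigr (fun=> (\sum_j y j) ^+ (L - m) *
    (\sum_v a v * \prod_i y (v i)))); last first.
  move=> s; rewrite inE => /injectiveP inj_s.
  rewrite (partition_big (comp^~ s) predT)//= mulr_sumr.
  apply: eq_bigr => v _.
  rewrite (eq_bigr (fun w : {ffun 'I_L -> J} =>
     a v * \prod_i y (w i))); last by move=> w /eqP <-; rewrite mulrC.
  rewrite -mulr_sumr mulrCA; congr (_ * _).
  (* The letters allowed at position [l]: only [v i] if [l = s i], every letter if [l] is not in the
     image of [s]. *)
  pose Q (l : 'I_L) : pred J :=
    fun j => [forall i, (s i == l) ==> (j == v i)].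
  transitivity (\prod_l \sum_(j | Q l j) y j).
    rewrite bigA_distr_big_dep; apply: eq_bigl => w.
    apply/eqP/familyP => [cw l|Qw].
      by apply/forallP => i; apply/implyP => /eqP <-; rewrite -cw ffunE.
    apply/ffunP => i; rewrite ffunE.
    by have /forallP/(_ i) := Qw (s i); rewrite eqxx => /eqP.
  rewrite (bigID (fun l => l \in codom s))/= [RHS]mulrC; congr (_ * _).
    rewrite -big_uniq /=; last by rewrite map_inj_uniq// enum_uniq.
    rewrite big_map big_enum /=; apply: eq_bigr => i _.
    rewrite (big_pred1 (v i))// => j.
    apply/forallP/eqP => [/(_ i)|-> k]; first by rewrite eqxx => /eqP.
    by apply/implyP => /eqP/inj_s->.
  rewrite (eq_bigr (fun=> \sum_j y j)); last first.
    move=> l ls; apply: eq_bigl => j; apply/forallP => i.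
    by apply/implyP => /eqP il; rewrite -il codom_f in ls.
  rewrite prodr_const; congr (_ ^+ _).
  have -> : #|(fun l => l \notin codom s)| = #|[predC codom s]| by [].
  by rewrite -[#|predC _|](addKn #|codom s|) cardC card_codom// !card_ord.
by rewrite sumr_const -[_ *+ #|_|]mulr_natl mulKf ?gt_eqF.
Qed.

End Polya.

(** * Smoothness of quotients of forms, and compactness of the simplex *)

Section Analysis.
Local Open Scope classical_set_scope.

Lemma hpoly_comp_continuous (R : realType) (J : finType) (T : topologicalType)
    (u : T -> J -> R) m f :
  (forall j, continuous (fun t => u t j)) -> hpoly m f ->
  continuous (fun t => f (u t)).
Proof.
move=> cu; elim=> {m f} [m|c|j|m f g _ IHf _ IHg|m k f g _ IHf _ IHg] x.
- exact: cst_continuous.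
- exact: cst_continuous.
- exact: cu.
- exact: cvgD (IHf x) (IHg x).
- exact: cvgM (IHf x) (IHg x).
Qed.

Section Regularity.
Variables (R : realType) (n : nat).
Implicit Types (x : 'rV[R]_n) (f g : ('I_n -> R) -> R).

Definition coords x : 'I_n -> R := fun i => x ord0 i.

Definition quot f g x : R := if x == 0 then 0 else f (coords x) / g (coords x).

Lemma coords_scale t x : coords (t *: x) = fun i => t * coords x i.
Proof. by apply/funext => i; rewrite /coords mxE. Qed.

Lemma hpoly_continuous m f :
  hpoly m f -> continuous (fun x => f (coords x)).
Proof. by apply: hpoly_comp_continuous => j; exact: coord_continuous. Qed.

(** Degree 0 is kept apart because the degree cannot drop further: in the product rule the
    derivative of a constant must vanish, not merely be constant, for the degrees to match. *)
Lemma hpoly_is_derive m f (i : 'I_n) : hpoly m f ->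
  exists f',
    (forall x, is_derive x (delta_mx ord0 i) (fun x => f (coords x))
       (f' (coords x) : R)) /\
    if m is k.+1 then hpoly k f' else f' = fun=> 0.
Proof.
elim=> {m f} [m|c|j|m f g _ [f' [Df hf]] _ [g' [Dg hg]]|
  m k f g hpf [f' [Df hf]] hpg [g' [Dg hg]]].
- exists (fun=> 0); split=> [x|]; first exact: is_derive_cst.
  by case: m => // m; exact: hpoly_zero.
- by exists (fun=> 0); split=> [x|//]; exact: is_derive_cst.
- exists (fun=> (j == i)%:R); split=> [x|]; last exact: hpoly_cst.
  have E (h : R) : h != 0 ->
      h^-1 *: ((h *: delta_mx ord0 i + x : 'rV[R]_n) ord0 j - x ord0 j) =
      (j == i)%:R.
    by move=> h0; rewrite !mxE eqxx addrK [_ *: _]mulKf.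
  have C : (fun h : R => h^-1 *: (((fun x => coords x j) \o shift x)
      (h *: delta_mx ord0 i) - coords x j)) @ 0^' --> ((j == i)%:R : R).
    apply: cvg_near_cst; near=> h; apply: E.
    by near: h; exact: nbhs_dnbhs_neq.
  by split; [apply/cvg_ex; exists (j == i)%:R|exact: cvg_lim C].
- exists (fun y => f' y + g' y); split=> [x|]; first exact: is_deriveD.
  case: m hf hg {Df Dg} => [-> ->|m hf hg]; last exact: hpoly_add.
  by apply/funext => y; rewrite addr0.
exists (fun y => f y * g' y + g y * f' y); split=> [x|].
  exact: (is_deriveM (Df x) (Dg x)).
case: m k hpf hpg hf hg {Df Dg} => [|m] [|k] hpf hpg /=.
- by move=> -> ->; apply/funext => y; rewrite !mulr0 addr0.
- move=> -> hg; apply: hpoly_eq (hpoly_mul hpf hg) _ _ => // y.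
  by rewrite mulr0 addr0.
- move=> hf ->; apply: hpoly_eq (hpoly_mul hpg hf) _ _ => [|y].
    by rewrite addn0.
  by rewrite mulr0 add0r.
move=> hf hg; apply: hpoly_add.
  by apply: hpoly_eq (hpoly_mul hpf hg) _ _; rewrite ?addSn ?addnS.
by apply: hpoly_eq (hpoly_mul hpg hf) _ _; rewrite ?addSn ?addnS// addnC.
Unshelve. all: by end_near.
Qed.

Lemma near_neq0 x : x != 0 -> \forall y \near x, y != 0.
Proof.
move=> x0; have : closed [set 0 : 'rV[R]_n].
  exact: accessible_closed_set1 (hausdorff_accessible (@norm_hausdorff _ _)) _.
move=> /closed_openC; rewrite openE => /(_ x) /=.
have /eqP x0' := x0; move=> /(_ x0'); apply: filterS => y /= ?.
exact/eqP.
Qed.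

Lemma quot_homog m e f g t x : hpoly (e + m)%N.+1 f -> hpoly e g -> t != 0 ->
  quot f g (t *: x) = t ^+ m.+1 * quot f g x.
Proof.
move=> hf hg t0; rewrite /quot scaler_eq0 (negPf t0) /=.
case: eqP => _; first by rewrite mulr0.
rewrite coords_scale (hpoly_homog _ _ hf) (hpoly_homog _ _ hg).
rewrite -addnS exprD invfM mulrACA [X in X * _ = _]mulrAC.
by rewrite mulfV ?expf_neq0// mul1r.
Qed.

Section Quotient.
Variables (e : nat) (g : ('I_n -> R) -> R).
Hypotheses (hg : hpoly e g) (g_neq0 : forall x, x != 0 -> g (coords x) != 0).

(** Only the origin needs an argument: by homogeneity the quotient is bounded by
    [C * |x| ^ (m + 1)], with [C] its maximum in absolute value on the unit sphere. *)
Lemma quot_continuous m f : hpoly (e + m)%N.+1 f -> continuous (quot f g).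
Proof.
move=> hf x; have [->|x0] := eqVneq x 0; last first.
  have E : \forall y \near x, f (coords y) * (g (coords y))^-1 = quot f g y.
    by near=> y; rewrite /quot ifN//; near: y; exact: near_neq0.
  rewrite /continuous_at {2}/quot (negPf x0).
  apply: cvg_trans (near_eq_cvg E) _.
  apply: cvgM; first exact: (hpoly_continuous hf).
  by apply: cvgV; [exact: g_neq0|exact: (hpoly_continuous hg)].
have [C HC] : exists C : R, forall x, `|quot f g x| <= C * `|x| ^+ m.+1.
  pose S := [set x : 'rV[R]_n | `|x| = 1].
  have cS : compact S.
    apply: bounded_closed_compact.
      exists 1; split=> // M M1 y; rewrite /S /= => ->; exact: ltW.
    have -> : S = (fun y : 'rV[R]_n => `|y|) @^-1` [set 1] by [].
    apply: closed_comp => [y _|]; first exact: norm_continuous.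
    exact: closed_eq.
  (* The sphere is empty only if the origin is the only point. *)
  have [S0|S0] := pselect (S !=set0); last first.
    exists 0 => y; have [->|y0] := eqVneq y 0.
      by rewrite /quot eqxx normr0 mul0r.
    case: S0; exists (`|y|^-1 *: y); rewrite /S /= normrZ normfV normr_id.
    by rewrite mulVf// normr_eq0.
  have [|c _ cmax] := @EVT_max_rV R n
    (fun y => `|f (coords y) / g (coords y)|) S S0 cS.
    apply: continuous_in_subspaceT => y; rewrite inE /S /= => y1.
    have y0 : y != 0 by rewrite -normr_eq0 y1 oner_neq0.
    apply: (@continuous_comp _ _ _ (fun y => f (coords y) / g (coords y))
      (fun t : R => `|t|)); last exact: norm_continuous.
    apply: continuousM; first exact: (hpoly_continuous hf).
    by apply: continuousV; [exact: g_neq0|exact: (hpoly_continuous hg)].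
  exists (`|f (coords c) / g (coords c)|) => y; have [->|y0] := eqVneq y 0.
    by rewrite /quot eqxx !normr0 expr0n mulr0.
  have ny0 : `|y| != 0 by rewrite normr_eq0.
  pose u := `|y|^-1 *: y.
  have uS : u \in S by rewrite inE /S /= normrZ normfV normr_id mulVf.
  have u0 : u != 0 by rewrite scaler_eq0 invr_eq0 (negPf ny0) (negPf y0).
  have yE : y = `|y| *: u by rewrite scalerA mulfV// scale1r.
  rewrite {1}yE (quot_homog _ hf hg ny0) normrM normrX normr_id.
  rewrite [X in X <= _]mulrC.
  by rewrite ler_wpM2r ?exprn_ge0// {1}/quot (negPf u0) cmax.
rewrite /continuous_at {2}/quot eqxx.
have F0 : Filter (nbhs (0 : 'rV[R]_n)) by exact: nbhs_filter.
apply: (@norm_cvg0 _ _ _ _ F0).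
apply: (@squeeze_cvgr _ _ F0 _ (fun=> 0) (fun y => C * `|y| ^+ m.+1)).
- by apply: nearW => y; rewrite normr_ge0 HC.
- exact: cvg_cst.
have -> : 0 = C * `|0 : 'rV[R]_n| ^+ m.+1 :> R by rewrite normr0 expr0n mulr0.
apply: cvgM; first exact: cvg_cst.
apply: (@continuous_comp _ _ _ (fun y : 'rV[R]_n => `|y|)
  (fun t : R => t ^+ m.+1)).
  exact: norm_continuous.
exact: exprn_continuous.
Unshelve. all: by end_near.
Qed.

End Quotient.

Lemma classC_quot m e f g : hpoly (e + m)%N.+1 f -> hpoly e g ->
  (forall x, x != 0 -> g (coords x) != 0) -> classC m (quot f g).
Proof.
elim: m e f g => [|m IH] e f g hf hg g_neq0 /=.
  exact: (quot_continuous hg g_neq0 hf).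
split=> [|i]; first exact: (quot_continuous hg g_neq0 hf).
have [f' [Df hf']] := hpoly_is_derive i hf.
have [g' [Dg hg']] := hpoly_is_derive i hg.
pose num y : R := f' y * g y - f y * g' y.
pose den y : R := g y ^+ 2.
have D x : is_derive x (delta_mx ord0 i) (quot f g) (quot num den x).
  (* At the origin, homogeneity turns the difference quotient into [h ^+ m.+1 * quot f g v], whose
     limit 0 is the default value of [quot num den] there. *)
  have [->|x0] := eqVneq x 0.
    have C : (fun h : R => h^-1 *: ((quot f g \o shift 0)
        (h *: delta_mx ord0 i) - quot f g 0)) @ 0^' --> (0 : R).
      pose v : 'rV[R]_n := delta_mx ord0 i.
      apply: (@cvg_trans _ ((fun h : R => h ^+ m.+1 * quot f g v) @ 0^')).
        apply: near_eq_cvg; near=> h => /=.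
        have h0 : h != 0 by near: h; exact: nbhs_dnbhs_neq.
        rewrite addr0 {3}/quot eqxx subr0 (quot_homog _ hf hg h0).
        rewrite [h ^+ m.+2]exprS -[h * _ * _]mulrA.
        by rewrite [_ *: _]mulKf.
      apply: cvg_within_filter.
      have : (h ^+ m.+1 * quot f g v) @[h --> (0 : R)] -->
          0 ^+ m.+1 * quot f g v.
        by apply: cvgM; [exact: exprn_continuous|exact: cvg_cst].
      by rewrite expr0n mul0r.
    rewrite {2}/quot eqxx.
    by split; [apply/cvg_ex; exists 0|exact: cvg_lim C].
  have E : \forall y \near x, f (coords y) * (g (coords y))^-1 = quot f g y.
    by near=> y; rewrite /quot ifN//; near: y; exact: near_neq0.
  apply: near_eq_is_derive E _.
  have gx0 := g_neq0 x x0.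
  have DV : is_derive x (delta_mx ord0 i) (fun y => (g (coords y))^-1)
      (- (g (coords x)) ^- 2 *: g' (coords x)).
    split; first exact: derivableV.
    by rewrite deriveV// derive_val.
  apply: is_derive_eq (is_deriveM (Df x) DV) _.
  rewrite /quot (negPf x0) /num /den /GRing.scale /=; by field.
split=> [x|]; first by have [] := D x.
rewrite (_ : (fun x => _) = quot num den); last first.
  by apply/funext => x; have [] := D x.
apply: (IH (e * 2)%N).
- apply: hpolyB.
    by apply: hpoly_eq (hpoly_mul hf' hg) _ _ => //; lia.
  (* If [e = 0], then [g'] is the zero function, which fits every degree. *)
  case: e hf hg hg' {IH hf'} => [|e] hf hg hg' /=.
    rewrite hg'; apply: hpoly_eq (hpoly_zero _ _ _) _ _ => // y.
    by rewrite mulr0.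
  by apply: hpoly_eq (hpoly_mul hf hg') _ _ => //; lia.
- exact: hpolyX.
- by move=> x x0; rewrite /den expf_neq0// g_neq0.
Unshelve. all: by end_near.
Qed.

End Regularity.

(** On the compact part of the simplex where [G <= 0], [H] has a positive minimum, so a large
    multiple of [H] outweighs the minimum of [G]; a second minimum, over the whole simplex, gives
    [delta]. *)
Lemma simplex_lower_bound (R : realType) (J : finType) m1 m2
    (G H : (J -> R) -> R) : hpoly m1 G -> hpoly m2 H ->
  (forall y, 0 <= H y) ->
  (forall y, (forall j, 0 <= y j) -> \sum_j y j = 1 -> H y = 0 -> 0 < G y) ->
  exists C delta : R, 0 < delta /\ forall y, (forall j, 0 <= y j) ->
    \sum_j y j = 1 -> delta <= G y + C * H y.
Proof.
move=> hG hH H_ge0 G_gt0.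
pose u (v : 'rV[R]_#|J|) (j : J) : R := v ord0 (enum_rank j).
have cu j : continuous (fun v => u v j) by exact: coord_continuous.
have cG := hpoly_comp_continuous cu hG.
have cH := hpoly_comp_continuous cu hH.
have csum : continuous (fun v => \sum_j u v j).
  apply: (@hpoly_comp_continuous _ _ _ _ 1 (fun y => \sum_j y j) cu).
  by apply: hpoly_sum => j _; exact: hpoly_var.
pose S := [set v : 'rV[R]_#|J| | forall i, `[0, 1]%classic (v ord0 i)] `&`
  [set v | \sum_j u v j = 1].
have cS : compact S.
  apply: compact_closedI.
    apply: (@rV_compact R _ (fun=> `[0, 1]%classic)) => i.
    exact: segment_compact.
  apply: (@closed_comp _ _ (fun v => \sum_j u v j) [set 1]) => [v _|].
    exact: csum.
  exact: closed_eq.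
have SP y : (forall j, 0 <= y j) -> \sum_j y j = 1 ->
    exists2 v, v \in S & u v = y.
  move=> y0 y1; exists (\row_i y (enum_val i)).
    rewrite inE; split=> [i|] /=.
      rewrite mxE in_itv /= y0 -y1 (bigD1 (enum_val i))//= lerDl.
      exact: sumr_ge0.
    by rewrite -[RHS]y1; apply: eq_bigr => j _; rewrite /u mxE enum_rankK.
  by apply/funext => j; rewrite /u mxE enum_rankK.
have PS v : v \in S -> (forall j, 0 <= u v j) /\ \sum_j u v j = 1.
  rewrite inE => -[v01 v1]; split=> // j.
  by have := v01 (enum_rank j); rewrite /= in_itv /= => /andP[].
have [S0|S0] := pselect (S !=set0); last first.
  exists 0, 1; split=> // y y0 y1; case: S0.
  by have [v] := SP y y0 y1; rewrite inE => Sv _; exists v.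
have [C HC] : exists C, forall v, v \in S -> 0 < G (u v) + C * H (u v).
  pose F := S `&` [set v | G (u v) <= 0].
  have cF : compact F.
    apply: compact_closedI cS _.
    apply: (@closed_comp _ _ (fun v => G (u v)) [set t | t <= 0]) => [v _|].
      exact: cG.
    exact: closed_le.
  have FS v : v \in F -> v \in S by rewrite !inE => -[].
  have [F0|F0] := pselect (F !=set0); last first.
    exists 0 => v vS; rewrite mul0r addr0 ltNge; apply/negP => Gv.
    by apply: F0; exists v; split=> //; rewrite inE in vS.
  have [c cF' cmin] := @EVT_min_rV R _ (fun v => H (u v)) F F0 cF
    (continuous_subspaceT cH).
  have [b _ bmin] := @EVT_min_rV R _ (fun v => G (u v)) F F0 cF
    (continuous_subspaceT cG).
  have Hc : 0 < H (u c).
    rewrite lt_neqAle H_ge0 andbT eq_sym; apply/eqP => Hc0.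
    have [c0 c1] := PS c (FS c cF').
    have := G_gt0 _ c0 c1 Hc0; rewrite ltNge => /negP; apply.
    by move: cF'; rewrite inE => -[].
  (* On [F] this gives [C * H >= |G (u b)| + 1], while [G >= G (u b)]. *)
  exists ((`|G (u b)| + 1) / H (u c)) => v vS.
  have C0 : 0 <= (`|G (u b)| + 1) / H (u c) by rewrite divr_ge0// addr_ge0.
  have [Gv|Gv] := leP (G (u v)) 0; last first.
    by rewrite ltr_wpDr// mulr_ge0.
  have vF : v \in F by rewrite inE; split=> //; rewrite inE in vS.
  have := bmin v vF; have := ler_norm (- G (u b)); rewrite normrN.
  have : (`|G (u b)| + 1) <= (`|G (u b)| + 1) / H (u c) * H (u v).
    rewrite mulrAC ler_pdivlMr// ler_wpM2l ?cmin// addr_ge0//.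
  by lra.
have [|d dS dmin] := @EVT_min_rV R _ (fun v => G (u v) + C * H (u v)) S S0 cS.
  apply: continuous_subspaceT => v.
  have cCH : {for v, continuous (fun v => C * H (u v))}.
    by apply: continuousM; [exact: cst_continuous|exact: cH].
  by apply: cvgD (cG v) cCH.
exists C, (G (u d) + C * H (u d)); split; first exact: HC.
by move=> y y0 y1; have [v vS <-] := SP y y0 y1; exact: dmin.
Qed.

End Analysis.

(** A Vandermonde matrix with the distinct nodes 0, ..., D, its columns scaled by nonzero binomial
    coefficients. It expresses the powers (x_b + h x_c)^D in the monomials x_b^(D-k) x_c^k. *)
Lemma binomial_vandermonde_unit (R : realType) D :
  (\matrix_(h < D.+1, k < D.+1) ((h%:R : R) ^+ k *+ 'C(D, k))) \in unitmx.
Proof.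
set W := (X in X \in _).
pose nodes : 'rV[R]_D.+1 := \row_h h%:R.
have -> : W = (Vandermonde D.+1 nodes)^T *m diag_mx (\row_k ('C(D, k))%:R).
  by apply/matrixP => h k; rewrite mul_mx_diag !mxE mulr_natr.
rewrite unitmxE det_mulmx det_tr det_Vandermonde det_diag unitfE mulf_neq0//.
  apply/prodf_neq0 => i _; apply/prodf_neq0 => j ij.
  by rewrite !mxE subr_eq0 eqr_nat gtn_eqF.
apply/prodf_neq0 => k _; rewrite mxE pnatr_eq0 -lt0n bin_gt0.
by rewrite -ltnS.
Qed.

Lemma exists_root (R : realType) D (a : R) : (0 < D)%N -> 0 <= a ->
  exists2 r : R, 0 <= r & r ^+ D = a.
Proof.
move=> D0 a0; exists (a `^ D%:R^-1); first exact: powR_ge0.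
by rewrite -powR_mulrn ?powR_ge0// -powRrM mulVf ?powRr1// pnatr_eq0 -lt0n.
Qed.

(** * The embedding by powers of linear forms and the equations of its image *)

Section Veronese.
Variables (R : realType) (n D : nat).
Hypothesis D_gt0 : (0 < D)%N.
Implicit Types (x : 'I_n -> R).

Definition vindex : finType := ('I_n * 'I_n * 'I_D.+1)%type.
Implicit Types (y : vindex -> R).

Definition linform (j : vindex) x : R := x j.1.1 + (j.2 : nat)%:R * x j.1.2.

Definition powers x (j : vindex) : R := linform j x ^+ D.

Definition binom_mx : 'M[R]_D.+1 := \matrix_(h, k) ((h%:R) ^+ k *+ 'C(D, k)).

(* The linear form in [y] that takes the value x_b^(D-k) x_c^k at
   [y = powers x]. *)
Definition mono (b c : 'I_n) (k : 'I_D.+1) y : R :=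
  \sum_h invmx binom_mx k h * y (b, c, h).

(** Since [y] need not lie in the image of [powers], this shows that any [y] at which all [mono]
    vanish is zero. *)
Lemma monoE b c y h : y (b, c, h) = \sum_k binom_mx h k * mono b c k y.
Proof.
pose z : 'cV[R]_D.+1 := \col_h y (b, c, h).
transitivity ((binom_mx *m (invmx binom_mx *m z)) h ord0).
  by rewrite mulmxA mulmxV ?mul1mx ?mxE// binomial_vandermonde_unit.
rewrite mxE; apply: eq_bigr => k _; congr (_ * _).
by rewrite mxE; apply: eq_bigr => h' _; rewrite mxE.
Qed.

Lemma mono_powers b c k x : mono b c k (powers x) = x b ^+ (D - k) * x c ^+ k.
Proof.
pose z : 'cV[R]_D.+1 := \col_k (x b ^+ (D - k) * x c ^+ k).
have E h : powers x (b, c, h) = (binom_mx *m z) h ord0.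
  rewrite /powers /linform /= exprDn mxE; apply: eq_bigr => i _.
  by rewrite !mxE exprMn mulrnAl mulrCA.
transitivity ((invmx binom_mx *m (binom_mx *m z)) k ord0).
  by rewrite [RHS]mxE; apply: eq_bigr => h _; rewrite E.
by rewrite mulmxA mulVmx ?binomial_vandermonde_unit// mul1mx mxE.
Qed.

(** For [h = 0] the linear form is the variable [x a] alone. *)
Definition diag (a : 'I_n) y : R := y (a, a, ord0).

Lemma diag_powers a x : diag a (powers x) = x a ^+ D.
Proof. by rewrite /diag /powers /linform /= mul0r addr0. Qed.

(** A linear substitute for the variable [x b]: on the image it is [x b] up to a factor that does
    not depend on [b]. *)
Definition mixed (a b : 'I_n) y : R := mono a b (inord 1) y.

Lemma mixed_powers a b x : mixed a b (powers x) = x a ^+ D.-1 * x b.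
Proof. by rewrite /mixed mono_powers inordK ?ltnS// subn1 expr1. Qed.

Lemma hpoly_mono b c k : hpoly 1 (mono b c k).
Proof. by apply: hpoly_sum => h _; apply: hpolyZ; exact: hpoly_var. Qed.

(* The first sum excludes points of the simplex with [diag a y = 0] for all
   [a]; if [diag a y <> 0], the second one makes [y] the image of the point
   with coordinates [mixed a b y / diag a y ^ ((D - 1) / D)]. *)
Definition relations y : R :=
  \sum_(t : vindex) (mono t.1.1 t.1.2 t.2 y ^+ D -
     diag t.1.1 y ^+ (D - t.2) * diag t.1.2 y ^+ t.2) ^+ 2 +
  \sum_(t : 'I_n * vindex) (y t.2 * diag t.1 y ^+ D.-1 -
     (mixed t.1 t.2.1.1 y + (t.2.2 : nat)%:R * mixed t.1 t.2.1.2 y) ^+ D) ^+ 2.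

Lemma hpoly_relations : hpoly (D * 2) relations.
Proof.
have hdiag a : hpoly 1 (diag a) by exact: hpoly_var.
apply: hpoly_add; apply: hpoly_sum => t _; apply: hpolyX; apply: hpolyB.
- by apply: hpoly_eq (hpolyX D (hpoly_mono _ _ _)) _ _ => //; rewrite mul1n.
- apply: hpoly_eq (hpoly_mul (hpolyX (D - t.2) (hdiag _))
    (hpolyX t.2 (hdiag _))) _ _ => //.
  by rewrite !mul1n subnK// -ltnS.
- apply: hpoly_eq (hpoly_mul (hpoly_var _ _) (hpolyX D.-1 (hdiag _))) _ _ => //.
  by rewrite mul1n add1n prednK.
- apply: hpoly_eq (hpolyX D (hpoly_add (hpoly_mono _ _ _)
    (hpolyZ _ (hpoly_mono _ _ _)))) _ _ => //.
  by rewrite mul1n.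
Qed.

Lemma relations_ge0 y : 0 <= relations y.
Proof. by apply: addr_ge0; apply: sumr_ge0 => t _; exact: sqr_ge0. Qed.

Lemma relations_powers x : relations (powers x) = 0.
Proof.
rewrite /relations !big1 ?addr0// => t _.
  rewrite diag_powers !mixed_powers /powers /linform.
  rewrite [_%:R * (_ * _)]mulrCA -mulrDr exprMn -exprM mulrC.
  by rewrite [(_ * D.-1)%N]mulnC exprM subrr expr0n.
rewrite mono_powers !diag_powers exprMn -!exprM [(D * _)%N]mulnC.
by rewrite [(D * _)%N]mulnC subrr expr0n.
Qed.

Lemma relations_eq0 y : (forall j, 0 <= y j) -> \sum_j y j = 1 ->
  relations y = 0 -> exists2 x, (exists a, x a != 0) & y = powers x.
Proof.
move=> y_ge0 y1 /eqP.
rewrite /relations paddr_eq0; last 2 first.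
- by apply: sumr_ge0 => t _; exact: sqr_ge0.
- by apply: sumr_ge0 => t _; exact: sqr_ge0.
rewrite !psumr_eq0; try by move=> t _; exact: sqr_ge0.
move=> /andP[/allP relA /allP relB].
have {}relA b c k : mono b c k y ^+ D = diag b y ^+ (D - k) * diag c y ^+ k.
  apply/eqP; have := relA (b, c, k) (mem_index_enum _).
  by rewrite sqrf_eq0 subr_eq0.
have {}relB a b c h : y (b, c, h) * diag a y ^+ D.-1 =
    (mixed a b y + (h : nat)%:R * mixed a c y) ^+ D.
  apply/eqP; have := relB (a, (b, c, h)) (mem_index_enum _).
  by rewrite sqrf_eq0 subr_eq0.
have y_neq0 : exists j, y j != 0.
  apply/existsP; apply: contra_eqT y1 => /existsPn y0.
  by rewrite big1 1?eq_sym ?oner_neq0// => j _; have /negPn/eqP := y0 j.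
(* Otherwise [relA] makes every [mono] vanish, because [D - k] and [k] add up to [D > 0], and then
   [y = 0]. *)
have [a ua] : exists a, diag a y != 0.
  apply/existsP; apply: contraT => /existsPn u0.
  have {}u0 a : diag a y = 0 by have /negPn/eqP := u0 a.
  exfalso; case: y_neq0 => -[[b c] h] /eqP; apply; rewrite monoE big1// => k _.
  have /eqP := relA b c k; rewrite !u0 -exprD subnK; last by rewrite -ltnS.
  by rewrite expr0n gtn_eqF// expf_eq0 D_gt0 => /eqP ->; rewrite mulr0.
have ua_gt0 : 0 < diag a y by rewrite lt_neqAle eq_sym ua y_ge0.
have [r r_ge0 rD] := exists_root D_gt0 (ltW ua_gt0).
have r0 : r != 0.
  by apply: contra_eq_neq rD => ->; rewrite expr0n gtn_eqF// eq_sym.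
(* As [r ^+ D = diag a y], [r] plays the role of the coordinate [x a], and [relB] divided by
   [diag a y ^+ D.-1] says that [y] is the image of [x]. *)
pose x b := mixed a b y / r ^+ D.-1.
have yx : y = powers x.
  apply/funext => -[[b c] h]; rewrite /powers /linform /=.
  rewrite /x mulrA -mulrDl exprMn -relB -rD exprVn -!exprM [(D * _)%N]mulnC.
  by rewrite mulfK// expf_neq0.
exists x => //; exists a; apply: contra ua => /eqP xa0.
by rewrite yx diag_powers xa0 expr0n gtn_eqF.
Qed.

(** Each variable [x j] is replaced by [mixed a j]; homogeneity collects the factors
    [x a ^+ D.-1]. *)
Lemma hpoly_lift m f (a : 'I_n) : hpoly m f ->
  exists2 F, hpoly m F & forall x, F (powers x) = x a ^+ (D.-1 * m) * f x.
Proof.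
elim=> {m f} [m|c|j|m f g _ [F hF EF] _ [G hG EG]|
    m k f g _ [F hF EF] _ [G hG EG]].
- by exists (fun=> 0) => [|x]; [exact: hpoly_zero|rewrite mulr0].
- exists (fun=> c) => [|x]; first exact: hpoly_cst.
  by rewrite muln0 mul1r.
- by exists (mixed a j) => [|x]; [exact: hpoly_mono|rewrite mixed_powers muln1].
- exists (fun y => F y + G y) => [|x]; first exact: hpoly_add.
  by rewrite EF EG mulrDr.
exists (fun y => F y * G y) => [|x]; first exact: hpoly_mul.
by rewrite EF EG mulnDr exprD mulrACA.
Qed.

End Veronese.

(** * Positive forms as sums of powers, up to a denominator *)

Section SumOfPowers.
Variables (R : realType) (n D m : nat) (P : ('I_n -> R) -> R).
Hypotheses (D_gt0 : (0 < D)%N) (D_even : ~~ odd D) (hP : hpoly (D * m) P).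
Hypothesis P_gt0 : forall x, (exists a, x a != 0) -> 0 < P x.

Let sum_even_gt0 k (x : 'I_n -> R) : ~~ odd k -> (exists a, x a != 0) ->
  0 < \sum_a x a ^+ k.
Proof.
move=> k_even [a xa]; rewrite (bigD1 a)//= ltr_wpDr//.
  by apply: sumr_ge0 => b _; exact: exprn_even_ge0.
by rewrite exprn_even_gt0// xa orbT.
Qed.

Lemma sum_of_powers : exists e B N (A : 'I_N -> ('I_n -> R) -> R),
  [/\ hpoly e B, forall x, (exists a, x a != 0) -> 0 < B x,
      forall i, hpoly (e + m) (A i) &
      forall x, P x * B x ^+ D = \sum_(i < N) A i x ^+ D].
Proof.
have /choice[F HF] (a : 'I_n) : exists F : (vindex n D -> R) -> R,
    hpoly (D * m) F /\
    forall x, F (@powers R n D x) = x a ^+ (D.-1 * (D * m)) * P x.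
  by have [F] := hpoly_lift D_gt0 a hP; exists F.
pose sigma (y : vindex n D -> R) := \sum_j y j.
have hsigma : hpoly 1 sigma by apply: hpoly_sum => j _; exact: hpoly_var.
pose tau (y : vindex n D -> R) := \sum_a diag a y ^+ (D.-1 * m).
have htau : hpoly (D.-1 * m) tau.
  apply: hpoly_sum => a _.
  apply: hpoly_eq (hpolyX (D.-1 * m) (hpoly_var _ _)) _ _ => //.
  by rewrite mul1n.
(* On the image the sum over [a] is [P * t], with [t] positive off the origin; the power of [tau]
   completes [t] to the [D]-th power [t ^+ D]. *)
pose G y := (\sum_a F a y) * tau y ^+ D.-1.
pose mG := (D * m + (D.-1 * m) * D.-1)%N.
have hG : hpoly mG G.
  apply: hpoly_mul; last exact: hpolyX.
  by apply: hpoly_sum => a _; have [] := HF a.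
pose s x := sigma (@powers R n D x).
pose t x := tau (@powers R n D x).
have tE x : t x = \sum_a x a ^+ (D.-1 * (D * m)).
  apply: eq_bigr => a _; rewrite diag_powers -exprM; congr (_ ^+ _).
  by rewrite mulnCA.
have t_gt0 x : (exists a, x a != 0) -> 0 < t x.
  by move=> x0; rewrite tE sum_even_gt0// !oddM (negPf D_even) andbF.
have powers_ge0 x (j : vindex n D) : 0 <= @powers R n D x j.
  exact: exprn_even_ge0.
have s_gt0 x : (exists a, x a != 0) -> 0 < s x.
  move=> [a xa]; rewrite /s /sigma (bigD1 (a, a, ord0))//= ltr_wpDr//.
    by apply: sumr_ge0.
  by rewrite -[powers _ _]/(diag _ _) diag_powers exprn_even_gt0// xa orbT.
have GE x : G (@powers R n D x) = P x * t x ^+ D.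
  have -> : t x ^+ D = t x * t x ^+ D.-1 by rewrite -exprS prednK.
  rewrite /G mulrA; congr (_ * _); rewrite tE mulr_sumr.
  by apply: eq_bigr => a _; have [_ ->] := HF a; rewrite mulrC.
have [C [delta [delta_gt0 Hdelta]]] :
    exists C delta : R, 0 < delta /\ forall y : vindex n D -> R,
      (forall j, 0 <= y j) -> \sum_j y j = 1 -> delta <= G y + C * relations y.
  apply: (simplex_lower_bound hG (hpoly_relations R n D_gt0)) => [y|y y0 y1 r0].
    exact: relations_ge0.
  have [x x0 ->] := relations_eq0 D_gt0 y0 y1 r0.
  by rewrite GE mulr_gt0 ?exprn_gt0 ?P_gt0 ?t_gt0.
(* Powers of [sigma], which is 1 on the simplex, bring both terms to the same degree. *)
pose G1 y := G y * sigma y ^+ (D * 2) + C * (relations y * sigma y ^+ mG).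
have hG1 : hpoly (mG + D * 2) G1.
  apply: hpoly_add.
    apply: hpoly_mul => //.
    by apply: hpoly_eq (hpolyX (D * 2) hsigma) _ _; rewrite ?mul1n.
  apply: hpolyZ; apply: hpoly_eq (hpoly_mul (hpoly_relations R n D_gt0)
    (hpolyX mG hsigma)) _ _ => //.
  by rewrite mul1n addnC.
have [a Ha] := hpoly_tensor hG1.
have [|L0 HL0] := @polya R _ _ a delta delta_gt0.
  move=> y y0 y1; rewrite -Ha /G1 /sigma y1 !expr1n !mulr1.
  exact: Hdelta.
(* The excess over the degree of [G1] is [D * L0], so that Polya's multiplier becomes a [D]-th power
   too. *)
pose L := (mG + D * 2 + D * L0)%N.
have [|c [c_ge0 Hc]] := HL0 L.
  by rewrite /L; nia.
have /choice[r Hr] (w : {ffun 'I_L -> vindex n D}) : exists r, r ^+ D = c w.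
  by have [r _ rD] := exists_root D_gt0 (c_ge0 w); exists r.
pose T := {ffun 'I_L -> vindex n D}.
exists (D.-1 * m * D + D * (2 + L0))%N, (fun x => t x * s x ^+ (2 + L0)), #|T|.
(* One summand for each word: on the image, its monomial is the [D]-th power of a product of linear
   forms. *)
exists (fun i x => r (enum_val i) * \prod_l linform (enum_val i l) x).
have hlin (j : vindex n D) : hpoly 1 (@linform R n D j).
  by apply: hpoly_add; [|apply: hpolyZ]; exact: hpoly_var.
have hpowers f k : hpoly k f -> hpoly (k * D) (fun x => f (@powers R n D x)).
  elim=> {f k} [k|b|j|k f g _ IHf _ IHg|k l f g _ IHf _ IHg].
  - exact: hpoly_zero.
  - exact: hpoly_cst.
  - exact: hpolyX.
  - exact: hpoly_add.
  - by apply: hpoly_eq (hpoly_mul IHf IHg) _ _; rewrite ?mulnDl.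
split.
- apply: hpoly_mul; first exact: hpowers htau.
  by apply: hpoly_eq (hpolyX (2 + L0) (hpowers _ _ hsigma)) _ _; rewrite ?mul1n.
- by move=> x x0; rewrite mulr_gt0 ?exprn_gt0 ?t_gt0 ?s_gt0.
- move=> i; apply: hpolyZ.
  apply: hpoly_eq (hpoly_prod (index_enum 'I_L)
    (fun l => hlin (enum_val i l))) _ _ => //.
  rewrite sum_nat_const card_ord muln1 /L /mG.
  case: D D_gt0 => // D' _ /=; ring.
move=> x.
transitivity (\sum_w c w * \prod_l @powers R n D x (w l)).
  rewrite -Hc -Ha /G1 relations_powers// mul0r mulr0 addr0 GE.
  have -> : (L - (mG + D * 2) = D * L0)%N by rewrite /L addnC addnK.
  rewrite -/(sigma _) -/(s x) exprMn -exprM [((2 + L0) * D)%N]mulnC mulnDr.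
  rewrite exprD.
  by ring.
rewrite (reindex (@enum_val _ (mem T))) /=; last first.
  by apply: onW_bij; exact: enum_val_bij.
apply: eq_bigr => i _; rewrite exprMn Hr; congr (_ * _).
by rewrite -prodrXl.
Qed.

End SumOfPowers.

(** * From multivariate polynomials to forms and regulous functions *)

Section MultivariatePolynomials.
Variables (R : realType) (n : nat).

Lemma form_hpoly e (p : mpoly.mpoly n R) : is_form e p ->
  hpoly e (fun y => mpoly.meval y p).
Proof.
move=> /mpoly.dhomogP hp.
have E y : \sum_(m <- mpoly.msupp p | m \in mpoly.msupp p)
    mpoly.mcoeff m p * \prod_i y i ^+ (m i) = mpoly.meval y p.
  by rewrite mpoly.mevalE [RHS]big_seq.
apply: hpoly_eq (hpoly_sum _ _) _ E => // m mp; apply: hpolyZ.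
have hX i : hpoly (1 * m i) (fun y : 'I_n -> R => y i ^+ m i).
  exact/hpolyX/hpoly_var.
apply: hpoly_eq (hpoly_prod (index_enum 'I_n) hX) _ _ => //.
transitivity (mpoly.mdeg m); last exact: hp.
rewrite mpoly.mdegE.
by apply: eq_bigr => i _; rewrite mul1n.
Qed.

Lemma hpoly_mpoly m (f : ('I_n -> R) -> R) : hpoly m f ->
  exists p : mpoly.mpoly n R, forall x, peval p x = f (coords x).
Proof.
elim=> {m f} [m|c|j|m f g _ [p Hp] _ [q Hq]|m k f g _ [p Hp] _ [q Hq]].
- by exists 0 => x; rewrite /peval mpoly.meval0.
- by exists (mpoly.mpolyC n c) => x; rewrite /peval mpoly.mevalC.
- by exists (mpoly.mpolyX R (mpoly.mnm1 j)) => x; rewrite /peval mpoly.mevalXU.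
- by exists (p + q) => x; rewrite /peval mpoly.mevalD -Hp -Hq.
- by exists (p * q) => x; rewrite /peval mpoly.mevalM -Hp -Hq.
Qed.

Lemma coords_neq0 (x : 'rV[R]_n) : (x != 0) <-> exists a, coords x a != 0.
Proof.
split=> [x0|[a xa]]; last by apply: contra xa => /eqP ->; rewrite /coords mxE.
apply/existsP; apply: contraT => /existsPn H; case/eqP: x0.
by apply/rowP => a; rewrite mxE; have /negPn/eqP := H a.
Qed.

Lemma regulous_quot e m (f g : ('I_n -> R) -> R) : (0 < n)%N ->
  hpoly (e + m).+1 f -> hpoly e g ->
  (forall x : 'rV_n, x != 0 -> g (coords x) != 0) -> regulous m (quot f g).
Proof.
move=> n_gt0 hf hg g0; split; first exact: classC_quot hf hg g0.
have [p Hp] := hpoly_mpoly hf; have [q Hq] := hpoly_mpoly hg.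
(* The complement of the origin is the union of the sets where one coordinate is nonzero. *)
exists [set x : 'rV[R]_n | x != 0]%classic; split.
- exists [set mpoly.mpolyX R (mpoly.mnm1 i) | i in [set: 'I_n]]%classic.
  apply/seteqP; split=> x /=.
    move=> /coords_neq0[a xa]; exists (mpoly.mpolyX R (mpoly.mnm1 a)).
      by exists a.
    by rewrite /peval mpoly.mevalXU.
  move=> [_ [a _ <-]]; rewrite /peval mpoly.mevalXU => xa.
  by apply/coords_neq0; exists a.
- exists (const_mx 1) => /=; apply/coords_neq0.
  by exists (Ordinal n_gt0); rewrite /coords mxE oner_neq0.
- exists p, q => x /= x0; rewrite Hp Hq; split; first exact: g0.
  by rewrite /quot (negPf x0).
Qed.

End MultivariatePolynomials.

(** * Decomposition of the quotient into powers and into squares *)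

Theorem theorem4p3 (R : realType) (n k d : nat) (p q : mpoly.mpoly n R)
    (degp degq : nat) (k_ge1 : (1 <= k)%N) (d_ge1 : (1 <= d)%N)
    (formp : is_form degp p) (formq : is_form degq q)
    (posp : positive_definite p) (posq : positive_definite q)
    (hdeg : degp = (degq + 2 * k * d)%N) :
  (exists (N : nat) (h : 'I_N -> 'rV[R]_n -> R),
      (forall i, regulous (k - 1) (h i)) /\
      (forall x, ratfun p q x = \sum_(i < N) h i x ^+ (2 * d))) /\
  (exists (N : nat) (g : 'I_N -> 'rV[R]_n -> R),
      (forall i, classC (k * d - 1) (g i)) /\
      (forall x, ratfun p q x = \sum_(i < N) g i x ^+ 2)).
Proof.
have [n0|n_gt0] := posnP n.
  have x0 (x : 'rV[R]_n) : x = 0.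
    by apply/rowP => i; have := leq_ltn_trans (leq0n i) (ltn_ord i);
      rewrite lt0n => /eqP.
  by split; exists 0%N, (fun _ _ => 0); split=> [[]//|x];
    rewrite big_ord0 /ratfun (x0 x) eqxx.
pose D := (2 * d)%N.
have D_gt0 : (0 < D)%N by rewrite muln_gt0.
have D_even : ~~ odd D by rewrite oddM.
have hp := form_hpoly formp; have hq := form_hpoly formq.
have q_gt0 (x : 'I_n -> R) : (exists a, x a != 0) -> 0 < mpoly.meval x q.
  have -> : x = coords (\row_i x i) by apply/funext => i; rewrite /coords mxE.
  by move=> /coords_neq0; exact: posq.
have p_gt0 (x : 'I_n -> R) : (exists a, x a != 0) -> 0 < mpoly.meval x p.
  have -> : x = coords (\row_i x i) by apply/funext => i; rewrite /coords mxE.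
  by move=> /coords_neq0; exact: posp.
(* The quotient is rewritten as [P / q ^+ D], whose denominator is a [D]-th power and whose
   numerator has degree divisible by [D]. *)
pose P (x : 'I_n -> R) := mpoly.meval x p * mpoly.meval x q ^+ D.-1.
have hP : hpoly (D * (degq + k)) P.
  apply: hpoly_eq (hpoly_mul hp (hpolyX D.-1 hq)) _ _ => //.
  rewrite hdeg -[in RHS](prednK D_gt0); move: (prednK D_gt0).
  by rewrite /D; nia.
have [|e [B [N [A [hB B_gt0 hA HA]]]]] :=
  @sum_of_powers R n D _ P D_gt0 D_even hP.
  by move=> x x0; rewrite mulr_gt0 ?exprn_gt0 ?p_gt0 ?q_gt0.
(* The common denominator: [p / q = P * B ^+ D / Q ^+ D]. Each [A i / Q] has degree [k], hence class
   [k - 1]. *)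
pose Q x := mpoly.meval x q * B x.
have hQ : hpoly (degq + e) Q by exact: hpoly_mul.
have Q_gt0 (x : 'rV[R]_n) : x != 0 -> 0 < Q (coords x).
  by move=> /coords_neq0 x0; rewrite mulr_gt0 ?q_gt0 ?B_gt0.
have Q_neq0 (x : 'rV[R]_n) : x != 0 -> Q (coords x) != 0.
  by move=> /Q_gt0; exact: lt0r_neq0.
have sumE x : ratfun p q x = \sum_(i < N) quot (A i) Q x ^+ D.
  rewrite /ratfun /quot; case: eqP => [_|/eqP x0].
    by rewrite big1// => i _; rewrite expr0n gtn_eqF.
  have /coords_neq0 cx := x0.
  rewrite (eq_bigr _ (fun i _ => expr_div_n _ _ _)) -mulr_suml -HA /P.
  have q0 : mpoly.meval (coords x) q != 0 by rewrite lt0r_neq0 ?q_gt0.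
  have B0 : B (coords x) != 0 by rewrite lt0r_neq0 ?B_gt0.
  have -> : Q (coords x) ^+ D = mpoly.meval (coords x) q *
      (mpoly.meval (coords x) q ^+ D.-1 * B (coords x) ^+ D).
    by rewrite mulrA -exprS prednK// -exprMn.
  rewrite -[X in _ = X / _]mulrA -mulf_div divff ?mulr1//.
  by rewrite mulf_neq0 ?expf_neq0.
split.
  exists N, (fun i => quot (A i) Q); split=> // i.
  apply: (@regulous_quot R n (degq + e)) => //.
  by apply: hpoly_eq (hA i) _ _ => //; lia.
(* The [d]-th power is taken inside the quotient: as one quotient of degree [k * d] it has class
   [k * d - 1], more than its factors provide. *)
exists N, (fun i => quot (fun y => A i y ^+ d) (fun y => Q y ^+ d)).
split=> [i|x].
  apply: (@classC_quot R n _ ((degq + e) * d)).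
  - by apply: hpoly_eq (hpolyX d (hA i)) _ _ => //; nia.
  - exact: hpolyX.
  - by move=> x x0; rewrite expf_neq0 ?Q_neq0.
rewrite sumE; apply: eq_bigr => i _; rewrite /D mulnC exprM; congr (_ ^+ 2).
rewrite /quot; case: eqP => _; first by rewrite expr0n gtn_eqF.
by rewrite expr_div_n.
Qed.
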